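(* Let $\Gamma=(V;E,\varepsilon)$ be a simple graph. Then there is an isomorphism of $R$-modules $$\mathbb{V}(\Gamma)\;\simeq\; m_{is}\,(\xi_0)\;\oplus\;\bigoplus_{e\in I_E} 2\,(\xi_e)\;\oplus\;\bigoplus_{x\in V_\gamma}(\xi_{\gamma(x)}),$$ where $k\,M$ denotes the direct sum of $k$ copies of $M$, and this is a decomposition into simple modules in which the modules $(\xi_0)$, $(\xi_e)$ for $e\in I_E$, and $(\xi_{\gamma(x)})$ for $x\in V_\gamma$ are simple, pairwise non-isomorphic $R$-modules which are ideals of $R$.
   Context: Graphs are finite. A graph is a triple $\Gamma=(V;E,\varepsilon)$ with vertex set $V$, edge set $E$ and a map $\varepsilon$ from $E$ to the set of subsets of $V$ with one or two elements; it is simple if every $\varepsilon(e)$ has exactly two elements and $\varepsilon$ is injective. A vertex $x$ is incident to $e$ if $x\in\varepsilon(e)$. It is assumed that $m=|E|\ge 1$. Fix an odd prime $p$ and an algebraic closure $\overline{\mathbb{F}}_p$ of $\mathbb{F}_p$. Let $\mathbb{E}=\mathbb{F}_2[E]$ be the $\mathbb{F}_2$-vector space with basis $E$, viewed as an abelian group with law written $\oplus$ and neutral element $0$. For $a=\oplus_{e\in E}a_e e\in\mathbb{E}$ ($a_e\in\{0,1\}$), let $\chi_a:\mathbb{E}\to\{\pm1\}\subset\mathbb{F}_p^\times$ be the group homomorphism with $\chi_a(e)=(-1)^{a_e}$ for $e\in E$. Define $\gamma:V\to\mathbb{E}$ by $\gamma(x)=\oplus_{e\in E,\ x\in\varepsilon(e)}e$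 (so $\gamma(x)=0$ if $x$ is isolated). Let $R=\overline{\mathbb{F}}_p[\mathbb{E}]$ be the group algebra of the group $\mathbb{E}$. Let $\mathbb{V}(\Gamma)=\overline{\mathbb{F}}_p[V]$ be the $\overline{\mathbb{F}}_p$-vector space with basis $V$, made into an $R$-module by $a\cdot x=\chi_{\gamma(x)}(a)\,x$ for $a\in\mathbb{E}$, $x\in V$, extended linearly. For $u\in\mathbb{E}$ let $\xi_u=\sum_{a\in\mathbb{E}}\chi_u(a)\,a\in R$, and let $(\xi_u)=\xi_u R$ be the principal ideal of $R$ it generates (products taken in the group algebra $R$; the paper writes this ideal $\xi_u\oplus R$). $I_V$ is the set of isolated vertices (vertices incident to no edge), $m_{is}=|I_V|$, $I_E$ is the set of isolated edges (edges $e$ such that both extremities of $e$ are incident to no other edge), and $V_\gamma=V\setminus\big(I_V\cup\bigcup_{e\in I_E}\varepsilon(e)\big)$. *)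

(* Defs.v *)
From HB Require Import structures.
From mathcomp Require Import all_boot all_order all_algebra.
From mathcomp Require Import boolp.

Set Implicit Arguments.
Unset Strict Implicit.
Unset Printing Implicit Defensive.

Import GRing.Theory.
Local Open Scope ring_scope.

Section Modules.
Variable R : pzRingType.

Definition module_iso (M N : lmodType R) : Prop :=
  exists f : {linear M -> N}, bijective f.

(* Prop-valued, so that arbitrary, not only decidable, submodules are meant. *)
Definition submodule (M : lmodType R) (S : M -> Prop) : Prop :=
  [/\ S 0, forall u v, S u -> S v -> S (u + v)
    & forall (a : R) u, S u -> S (a *: u)].

Definition simple_module (M : lmodType R) : Prop :=
  (exists u : M, u != 0) /\
  forall S : M -> Prop, submodule S ->
    (forall u, S u <-> u = 0) \/ (forall u, S u).

End Modules.

(* Direct sum of a finite family of modules; as the index type is finite it is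
   the set of all dependent families. *)
Section DirectSum.
Variables (R : pzRingType) (I : finType) (M : I -> lmodType R).

Definition dsum := {dffun forall i : I, M i}.
HB.instance Definition _ := Choice.on dsum.

Implicit Types f g : dsum.

Definition dsum_zero : dsum := [ffun i => (0 : M i)].
Definition dsum_opp f : dsum := [ffun i => - f i].
Definition dsum_add f g : dsum := [ffun i => f i + g i].
Definition dsum_scale (a : R) f : dsum := [ffun i => a *: f i].

Fact dsum_addA : associative dsum_add.
Proof. by move=> f g h; apply/ffunP=> i; rewrite !ffunE addrA. Qed.
Fact dsum_addC : commutative dsum_add.
Proof. by move=> f g; apply/ffunP=> i; rewrite !ffunE addrC. Qed.
Fact dsum_add0 : left_id dsum_zero dsum_add.
Proof. by move=> f; apply/ffunP=> i; rewrite !ffunE add0r. Qed.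
Fact dsum_addN : left_inverse dsum_zero dsum_opp dsum_add.
Proof. by move=> f; apply/ffunP=> i; rewrite !ffunE addNr. Qed.
HB.instance Definition _ :=
  GRing.isZmodule.Build dsum dsum_addA dsum_addC dsum_add0 dsum_addN.

Fact dsum_scaleA a b f : dsum_scale a (dsum_scale b f) = dsum_scale (a * b) f.
Proof. by apply/ffunP=> i; rewrite !ffunE scalerA. Qed.
Fact dsum_scale1 : left_id 1 dsum_scale.
Proof. by move=> f; apply/ffunP=> i; rewrite !ffunE scale1r. Qed.
Fact dsum_scaleDr : right_distributive dsum_scale +%R.
Proof. by move=> a f g; apply/ffunP=> i; rewrite !ffunE scalerDr. Qed.
Fact dsum_scaleDl f : {morph dsum_scale^~ f : a b / a + b}.
Proof. by move=> a b; apply/ffunP=> i; rewrite !ffunE scalerDl. Qed.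
HB.instance Definition _ := GRing.Zmodule_isLmodule.Build R dsum
  dsum_scaleA dsum_scale1 dsum_scaleDr dsum_scaleDl.

End DirectSum.

Section Ideals.
Variable R : comNzRingType.

(* [idealr_closed] of the library also requires the ideal to be proper. *)
Definition is_ideal (S : R -> Prop) : Prop :=
  [/\ S 0, forall u v, S u -> S v -> S (u + v) & forall a u, S u -> S (a * u)].

Variable x : R.

Definition principal_ideal : {pred R^o} :=
  [pred r : R^o | `[< exists s : R, r = x * s >]].

Lemma principal_idealP (r : R) :
  reflect (exists s, r = x * s) (r \in principal_ideal).
Proof. exact: asboolP. Qed.

Fact principal_ideal_submod : submod_closed principal_ideal.
Proof.
split=> [|a u v /principal_idealP[s ->] /principal_idealP[t ->]];
  apply/principal_idealP; first by exists 0; rewrite mulr0.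
by exists (a * s + t); rewrite mulrDr mulrCA.
Qed.
HB.instance Definition _ :=
  GRing.isSubmodClosed.Build R R^o principal_ideal principal_ideal_submod.

(* The ideal as an R-module *)
Record pideal : Type :=
  PIdeal { pideal_val : R^o; _ : pideal_val \in principal_ideal }.
HB.instance Definition _ := [isSub for pideal_val].
HB.instance Definition _ := [Choice of pideal by <:].
HB.instance Definition _ := [SubChoice_isSubLmodule of pideal by <:].

End Ideals.

(* Group algebra of a finite abelian group A, written additively: functions
   A -> K with the convolution product. *)
Section GroupAlgebra.
Variables (K : comNzRingType) (A : finZmodType).

Definition galg := {ffun A -> K^o}.
HB.instance Definition _ := GRing.Lmodule.on galg.

Implicit Types f g h : galg.

Definition gelt (a : A) : galg := [ffun b => (b == a)%:R].
Definition galg_mul f g : galg := [ffun a => \sum_b f b * g (a - b)].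

Fact galg_mulC : commutative galg_mul.
Proof.
move=> f g; apply/ffunP=> a; rewrite !ffunE.
rewrite (reindex_inj (subrI a)) /=.
by apply: eq_bigr => b _; rewrite subKr mulrC.
Qed.
Fact galg_mulA : associative galg_mul.
Proof.
move=> f g h; apply/ffunP=> a; rewrite !ffunE.
under eq_bigr => b _ do rewrite ffunE mulr_sumr.
under [RHS]eq_bigr => c _ do rewrite ffunE mulr_suml.
rewrite [RHS]exchange_big; apply: eq_bigr => b _ /=.
rewrite [RHS](reindex_inj (addrI b)) /=; apply: eq_bigr => c _.
by rewrite mulrA [b + c - b]addrAC subrr add0r opprD addrA.
Qed.
Fact galg_mul1 : left_id (gelt 0) galg_mul.
Proof.
move=> f; apply/ffunP=> a; rewrite !ffunE (bigD1 0) //= big1.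
  by rewrite ffunE eqxx mul1r subr0 addr0.
by move=> b /negbTE b0; rewrite ffunE b0 mul0r.
Qed.
Fact galg_mulDl : left_distributive galg_mul +%R.
Proof.
move=> f g h; apply/ffunP=> a; rewrite !ffunE -big_split /=.
by apply: eq_bigr => b _; rewrite ffunE mulrDl.
Qed.
Fact galg_1neq0 : gelt 0 != 0.
Proof.
by apply/eqP=> /ffunP/(_ 0)/eqP; rewrite !ffunE eqxx oner_eq0.
Qed.
HB.instance Definition _ := GRing.Zmodule_isComNzRing.Build galg
  galg_mulA galg_mulC galg_mul1 galg_mulDl galg_1neq0.

Fact galg_scaleAl (k : K) f g : k *: (f * g) = k *: f * g.
Proof.
apply/ffunP=> a; rewrite !ffunE [LHS]mulr_sumr.
by apply: eq_bigr => b _; rewrite ffunE mulrA.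
Qed.
HB.instance Definition _ := GRing.Lmodule_isLalgebra.Build K galg galg_scaleAl.
HB.instance Definition _ := GRing.Lalgebra_isComAlgebra.Build K galg.

Lemma geltM (a b : A) : gelt a * gelt b = gelt (a + b).
Proof.
apply/ffunP=> c; rewrite !ffunE (bigD1 a) //= big1.
  by rewrite !ffunE eqxx mul1r addr0 subr_eq addrC.
by move=> d /negbTE da; rewrite ffunE da mul0r.
Qed.

Lemma galgE f : f = \sum_a f a *: gelt a.
Proof.
apply/ffunP=> a; rewrite sum_ffunE (bigD1 a) //= big1.
  by rewrite !ffunE eqxx addr0 [RHS]mulr1.
by move=> b /negbTE ba; rewrite !ffunE eq_sym ba [LHS]mulr0.
Qed.

End GroupAlgebra.

Record graph : Type := Graph {
  vertex : finType;
  edge : finType;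
  ends : edge -> {set vertex};
  ends_card : forall e, (1 <= #|ends e| <= 2)%N }.

Definition simple_graph (G : graph) : Prop :=
  (forall e : edge G, #|ends e| = 2%N) /\ injective (@ends G).

Section GraphModule.
Variables (G : graph) (K : fieldType).

Definition edge_space := {ffun edge G -> 'F_2}.
HB.instance Definition _ := Finite.on edge_space.
HB.instance Definition _ := GRing.Zmodule.on edge_space.

Definition edge_vec (e : edge G) : edge_space := [ffun e' => (e' == e)%:R].

Definition gamma (x : vertex G) : edge_space :=
  \sum_(e : edge G | x \in ends e) edge_vec e.

Definition isolated_vertices : {set vertex G} :=
  [set x | [forall e : edge G, x \notin ends e]].

Definition isolated_edges : {set edge G} :=
  [set e | [forall x in ends e, forall e' : edge G,
              (x \in ends e') ==> (e' == e)]].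

Definition V_gamma : {set vertex G} :=
  ~: (isolated_vertices :|: \bigcup_(e in isolated_edges) ends e).

(* The coordinates a e, b e : 'F_2 are read as the naturals 0 or 1.  The two
   lemmas below characterize chi. *)
Definition chi (a b : edge_space) : K := \prod_e (-1) ^+ (a e * b e)%N.

Lemma chiD a b c : chi a (b + c) = chi a b * chi a c.
Proof.
rewrite /chi -big_split /=; apply: eq_bigr => e _; rewrite ffunE -exprD -mulnDr.
rewrite -signr_odd -[RHS]signr_odd !oddM; congr (_ ^+ (_ && _)).
by case: (b e) (c e) => [[|[|?]] ?] [[|[|?]] ?].
Qed.

Lemma chi_edge a e : chi a (edge_vec e) = (-1) ^+ (a e : nat).
Proof.
rewrite /chi (bigD1 e) //= ffunE eqxx muln1 big1 ?mulr1 // => e' /negbTE ne.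
by rewrite ffunE ne muln0.
Qed.

Definition Ralg := galg K edge_space.
HB.instance Definition _ := GRing.ComAlgebra.on Ralg.

Definition xi (u : edge_space) : Ralg :=
  \sum_(a : edge_space) chi u a *: (gelt K a : Ralg).

Definition xi_ideal (u : edge_space) : lmodType Ralg := pideal (xi u).

Definition graph_module := {ffun vertex G -> K}.
HB.instance Definition _ := GRing.Zmodule.on graph_module.

Implicit Types (r s : Ralg) (f g : graph_module).

Definition vertex_vec (x : vertex G) : graph_module := [ffun y => (y == x)%:R].

(* The linear extension of a . x = chi_(gamma x)(a) x in both arguments *)
Definition graph_scale r f : graph_module :=
  [ffun x => (\sum_a r a * chi (gamma x) a) * f x].

Fact graph_scaleA r s f : graph_scale r (graph_scale s f) = graph_scale (r * s) f.
Proof.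
apply/ffunP=> x; rewrite !ffunE mulrA; congr (_ * _).
under [RHS]eq_bigr => a _ do rewrite ffunE mulr_suml.
rewrite [RHS]exchange_big mulr_suml; apply: eq_bigr => b _ /=.
rewrite [RHS](reindex_inj (addrI b)) mulr_sumr; apply: eq_bigr => c _ /=.
by rewrite chiD mulrACA [b + c - b]addrAC subrr add0r.
Qed.
Fact graph_scale1 : left_id 1 graph_scale.
Proof.
move=> f; apply/ffunP=> x; rewrite !ffunE (bigD1 0) //= big1.
  rewrite ffunE eqxx mul1r addr0 /chi big1 ?mul1r // => e _.
  by rewrite ffunE muln0.
by move=> a /negbTE a0; rewrite ffunE a0 mul0r.
Qed.
Fact graph_scaleDr : right_distributive graph_scale +%R.
Proof. by move=> r f g; apply/ffunP=> x; rewrite !ffunE mulrDr. Qed.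
Fact graph_scaleDl f : {morph graph_scale^~ f : r s / r + s}.
Proof.
move=> r s; apply/ffunP=> x; rewrite !ffunE -mulrDl -big_split.
by congr (_ * _); apply: eq_bigr => a _; rewrite ffunE mulrDl.
Qed.
HB.instance Definition _ := GRing.Zmodule_isLmodule.Build Ralg graph_module
  graph_scaleA graph_scale1 graph_scaleDr graph_scaleDl.

Lemma graph_module_constE (k : K) f :
  (k%:A : Ralg) *: f = [ffun x => k * f x].
Proof.
apply/ffunP=> x; rewrite !ffunE (bigD1 0) //= big1.
  rewrite !ffunE eqxx addr0 /chi big1 => [|e _]; last by rewrite ffunE muln0.
  by rewrite mulr1 [_ *: _]mulr1.
by move=> a /negbTE a0; rewrite !ffunE a0 [_ *: _]mulr0 mul0r.
Qed.

Lemma graph_module_geltE a x :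
  (gelt K a : Ralg) *: vertex_vec x =
  ((chi (gamma x) a)%:A : Ralg) *: vertex_vec x.
Proof.
rewrite graph_module_constE; apply/ffunP=> y; rewrite !ffunE.
have [-> | _] := eqVneq y x; last by rewrite !mulr0.
rewrite !mulr1 (bigD1 a) //= big1; first by rewrite ffunE eqxx mul1r addr0.
by move=> b /negbTE ba; rewrite ffunE ba mul0r.
Qed.

(* Indices of the simple modules occurring in the decomposition: one for
   (xi_0), the isolated edges, the vertices in V_gamma *)
Definition simple_index : Type :=
  (unit + {e | e \in isolated_edges} + {x | x \in V_gamma})%type.

Definition simple_label (i : simple_index) : edge_space :=
  match i with
  | inl (inl _) => 0
  | inl (inr e) => edge_vec (val e)
  | inr x => gamma (val x)
  end.

End GraphModule.

(* Main.v *)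
(** Every ideal (xi_u) is a K-line on which a in E acts by the character chi_u:
    indeed a xi_u = chi_u(a) xi_u, and xi_u is nonzero.  So these modules are
    simple, and (xi_u), (xi_v) are isomorphic only if chi_u = chi_v, that is
    u = v, as -1 <> 1 in K.  A vertex x spans a line of V(Gamma) isomorphic to
    (xi_(gamma x)), where gamma x = 0 for x isolated and gamma x = e for x an
    end of an isolated edge e.  Finally, if gamma x = gamma y <> 0 with x <> y,
    then an edge through x joins x to y, and by simplicity it is the only edge
    through x or y, so it is isolated: gamma is injective on V_gamma. *)
From HB Require Import structures.
Require Import Defs.
From mathcomp Require Import all_boot all_order all_algebra.
From mathcomp Require Import boolp.

Set Implicit Arguments.
Unset Strict Implicit.
Unset Printing Implicit Defensive.

Import GRing.Theory.

Local Open Scope ring_scope.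

(** * Signs in a field of odd characteristic *)

Lemma F2_sign_inj (K : fieldType) (a b : 'F_2) : -1 != 1 :> K ->
  (-1) ^+ (a : nat) = (-1) ^+ (b : nat) :> K -> a = b.
Proof.
move=> /eqP n1; case: a b => [[|[|?]] ?] [[|[|?]] ?] //= H; apply/val_inj => //=.
by case: n1; rewrite -[LHS]expr1 -H.
Qed.

(** A morphism out of a field is injective, so it suffices that 1 + 1 is nonzero in ['F_p], which
    holds as p is at least 3. *)
Lemma rmorph_Fp_N1_neq1 (p : nat) (K : fieldType) (iota : {rmorphism 'F_p -> K}) :
  prime p -> odd p -> -1 != 1 :> K.
Proof.
move=> p_prime p_odd; rewrite -(rmorph1 iota) -rmorphN (inj_eq (fmorph_inj iota)).
rewrite eq_sym -subr_eq0 opprK; apply/eqP => /(congr1 val) /=.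
case: p p_prime p_odd iota => [|[|[|p]]] // p_prime _ _.
by rewrite /= !Fp_cast // !modn_small.
Qed.

(** * The ideals [(xi_u)]: simplicity and isomorphism classes *)

Section SimpleModules.
Variables (G : graph) (K : fieldType).
Implicit Types (u v a b : edge_space G) (r : Ralg G K).

Lemma edge_space_oppr a : - a = a.
Proof.
apply/ffunP=> e; rewrite !ffunE.
by case: (a e) => [[|[|?]] ?]; apply/val_inj.
Qed.

Lemma chi0 u : chi K u 0 = 1.
Proof. by rewrite /chi big1 // => e _; rewrite ffunE muln0. Qed.

Lemma xiE u a : xi K u a = chi K u a.
Proof.
rewrite sum_ffunE (bigD1 a) //= !ffunE eqxx big1 ?addr0 ?[_ *: _]mulr1 //.
by move=> b /negbTE ba; rewrite !ffunE eq_sym ba [_ *: _]mulr0.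
Qed.

Lemma scale_xi_at0 u (c : K) : (c *: xi K u) 0 = c.
Proof. by rewrite ffunE xiE chi0 [_ *: _]mulr1. Qed.

(** The linear extension of the character [chi u] to the group algebra. *)
Definition eval_chi u r : K := \sum_a r a * chi K u a.

(** The convolution has coefficient sum_b r(b) chi_u(a - b) at a; since -b = b, the factor chi_u(a)
    comes out and leaves [eval_chi u r]. *)
Lemma mul_xi u r : xi K u * r = eval_chi u r *: xi K u.
Proof.
rewrite mulrC; apply/ffunP=> a; rewrite !ffunE [RHS]mulr_suml xiE.
apply: eq_bigr => b _; rewrite xiE chiD edge_space_oppr.
by rewrite -mulrA [chi K u b * _]mulrC.
Qed.

Lemma eval_chi_const u (c : K) : eval_chi u c%:A = c.
Proof.
rewrite /eval_chi (bigD1 0) //= big1 => [|a /negbTE a0].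
  by rewrite !ffunE eqxx addr0 chi0 mulr1 [_ *: _]mulr1.
by rewrite !ffunE a0 [_ *: _]mulr0 mul0r.
Qed.

Lemma eval_chi_gelt u a : eval_chi u (gelt K a) = chi K u a.
Proof.
rewrite /eval_chi (bigD1 a) //= big1 => [|b /negbTE ba].
  by rewrite ffunE eqxx mul1r addr0.
by rewrite ffunE ba mul0r.
Qed.

Lemma xi_line_subproof u (c : K) : c *: xi K u \in principal_ideal (xi K u).
Proof.
by apply/principal_idealP; exists c%:A; rewrite mul_xi eval_chi_const.
Qed.

Definition xi_line u (c : K) : xi_ideal K u := PIdeal (xi_line_subproof u c).
(** The coefficient at 0 is the coordinate along [xi u], because [xi u] has coefficient chi_u(0) = 1
    there. *)
Definition xi_coord u (w : xi_ideal K u) : K := val w 0.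

Lemma xi_lineK u : cancel (xi_line u) (@xi_coord u).
Proof.
by move=> c; apply: scale_xi_at0.
Qed.

Lemma xi_coordK u : cancel (@xi_coord u) (xi_line u).
Proof.
move=> w; have /principal_idealP[s ws] := valP w; apply/val_inj.
rewrite /= /xi_coord [pideal_val w]ws [\val w]ws mul_xi.
by rewrite scale_xi_at0.
Qed.

Lemma xi_line_linear u r (c d : K) :
  xi_line u (eval_chi u r * c + d) = r *: xi_line u c + xi_line u d.
Proof.
apply/val_inj; rewrite /= scalerDl -scalerA; congr (_ + _).
by rewrite -[RHS]/(r * (c *: xi K u)) -scalerAr mulrC mul_xi scalerA mulrC -scalerA.
Qed.

Lemma xi_line0 u : xi_line u 0 = 0.
Proof. by apply/val_inj; rewrite /= scale0r. Qed.

Lemma xi_line_scale u r (c : K) : r *: xi_line u c = xi_line u (eval_chi u r * c).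
Proof. by rewrite -[LHS]addr0 -xi_line0 -xi_line_linear addr0. Qed.

Lemma xi_ideal_simple u : simple_module (xi_ideal K u).
Proof.
split=> [|S [S0 SD SZ]].
  exists (xi_line u 1); rewrite -xi_line0 (inj_eq (can_inj (xi_lineK u))).
  exact: oner_neq0.
have [[w [Sw /eqP w0]] | noS] := EM (exists w, S w /\ w <> 0).
  right=> v; rewrite -[v]xi_coordK.
  have c0 : xi_coord w != 0.
    by apply: contraNneq w0 => c0; rewrite -[w]xi_coordK c0 xi_line0.
  (* The quotient of the two coordinates, as a constant of R, carries w to v. *)
  rewrite -[xi_coord v](divfK c0) -[_ / _](eval_chi_const u) -xi_line_scale.
  by rewrite xi_coordK; apply: SZ.
left=> w; split=> [Sw | ->] //.
by have [//| w0] := eqVneq w 0; case: noS; exists w; split=> //; apply/eqP.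
Qed.

Lemma xi_ideal_iso_eq u v : -1 != 1 :> K ->
  module_iso (xi_ideal K u) (xi_ideal K v) -> u = v.
Proof.
move=> n1 [f /bij_inj f_inj]; apply/ffunP=> e; apply: (F2_sign_inj n1).
(* The coordinate at e is read off from the action of the single group element e. *)
rewrite -!chi_edge; set a := edge_vec e.
set c := xi_coord (f (xi_line u 1)).
(* Linearity over the constants of R makes f multiplication by c in coordinates. *)
have fE (k : K) : f (xi_line u k) = xi_line v (k * c).
  have := linearZZ f (k%:A : Ralg G K) (xi_line u 1).
  rewrite /= xi_line_scale eval_chi_const mulr1 => ->.
  by rewrite -[f _]xi_coordK xi_line_scale eval_chi_const.
have c0 : c != 0.
  apply: contra_neq (oner_neq0 K) => c0; apply: (can_inj (xi_lineK u)).
  by apply: f_inj; rewrite !fE c0 !mulr0.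
(* Commuting f with the action of a gives chi_u(a) c = chi_v(a) c, and c cancels. *)
have := linearZZ f (gelt K a : Ralg G K) (xi_line u 1).
rewrite /= xi_line_scale !fE xi_line_scale !eval_chi_gelt mulr1 mul1r.
by move=> /(can_inj (xi_lineK v))/(mulIf c0).
Qed.

End SimpleModules.

(** * The map [gamma] and the labels of the simple modules *)

Section Labels.
Variable G : graph.
Implicit Types (x y : vertex G) (e : edge G).

Lemma gammaE x e : gamma x e = (x \in ends e)%:R.
Proof.
rewrite sum_ffunE; have [xe | xe] := boolP (x \in ends e).
  rewrite (bigD1 e) //= ffunE eqxx big1 ?addr0 // => e' /andP[_ /negbTE ne].
  by rewrite ffunE eq_sym ne.
rewrite big1 // => e' xe'; rewrite ffunE; case: eqP => // ee.
by rewrite ee xe' in xe.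
Qed.

Lemma gamma_eqP x y : gamma x = gamma y -> forall e, (x \in ends e) = (y \in ends e).
Proof.
move=> /ffunP gxy e; have := gxy e; rewrite !gammaE.
by case: (x \in _); case: (y \in _).
Qed.

Lemma edge_vec_inj : injective (@edge_vec G).
Proof.
move=> e e' /ffunP/(_ e)/eqP; rewrite !ffunE eqxx.
by case: (e =P e').
Qed.

Lemma edge_vec_neq0 e : edge_vec e <> 0.
Proof. by move=> /ffunP/(_ e)/eqP; rewrite !ffunE eqxx. Qed.

Lemma gamma_isolated x : x \in isolated_vertices G -> gamma x = 0.
Proof.
rewrite inE => /forallP xi0; apply/ffunP=> e.
by rewrite gammaE ffunE (negbTE (xi0 e)).
Qed.

Lemma isolated_edge_eq e e' x :
  e \in isolated_edges G -> x \in ends e -> x \in ends e' -> e' = e.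
Proof.
by rewrite inE => /forall_inP he xe xe'; have /forallP/(_ e')/implyP/(_ xe')/eqP := he x xe.
Qed.

Lemma gamma_isolated_edge e x :
  e \in isolated_edges G -> x \in ends e -> gamma x = edge_vec e.
Proof.
move=> he xe; apply/ffunP=> e'; rewrite gammaE ffunE; congr (_ %:R); congr nat_of_bool.
by apply/idP/eqP => [|-> //]; apply: isolated_edge_eq.
Qed.

Lemma V_gammaP x :
  reflect ((exists e, x \in ends e) /\
           forall e, e \in isolated_edges G -> x \notin ends e) (x \in V_gamma G).
Proof.
rewrite !inE negb_or negb_forall; apply: (iffP andP).
  move=> [/existsP[e xe] xI]; split; first by exists e; rewrite negbK in xe.
  by move=> e' he'; apply: contra xI => xe'; apply/bigcupP; exists e'.
move=> [[e xe] xI]; split; first by apply/existsP; exists e; rewrite negbK.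
by apply/bigcupP => -[e' he']; apply/negP/xI.
Qed.

Lemma gamma_neq0 x : x \in V_gamma G -> gamma x <> 0.
Proof.
by case/V_gammaP=> -[e xe] _ /ffunP/(_ e)/eqP; rewrite gammaE xe ffunE.
Qed.

Lemma gamma_neq_isolated_edge x e :
  x \in V_gamma G -> e \in isolated_edges G -> gamma x <> edge_vec e.
Proof.
case/V_gammaP=> _ xI he /ffunP/(_ e)/eqP.
by rewrite gammaE ffunE eqxx (negbTE (xI e he)).
Qed.

Hypothesis G_simple : simple_graph G.

Lemma simple_ends e x y : x != y -> x \in ends e -> y \in ends e ->
  ends e = [set x; y].
Proof.
move=> xy xe ye; apply/eqP; rewrite eq_sym eqEcard cards2 xy G_simple.1 andbT.
by apply/subsetP=> z /set2P[] ->.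
Qed.

Lemma gamma_inj : {in V_gamma G &, injective (@gamma G)}.
Proof.
move=> x y /V_gammaP[[e xe] xI] _ /gamma_eqP gxy.
have [//| xy] := eqVneq x y.
have ye : y \in ends e by rewrite -gxy.
(* A vertex of [V_gamma] is not an end of an isolated edge. *)
suff /xI : e \in isolated_edges G by rewrite xe.
have Ee := simple_ends xy xe ye; rewrite inE Ee.
apply/forall_inP=> z zxy; apply/forallP=> e'; apply/implyP=> ze'.
have xe' : x \in ends e' by case/set2P: zxy ze' => -> //; rewrite gxy.
(* Both e and e' have x and y as their ends, hence coincide as there are no multiple edges. *)
by apply/eqP/G_simple.2; rewrite Ee; apply: simple_ends; rewrite -?gxy.
Qed.

(** The three kinds of labels do not meet: on [V_gamma], [gamma] avoids 0 since some edge passes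
    through x, and avoids an isolated e since x is not an end of e. *)
Lemma simple_label_inj : injective (@simple_label G).
Proof.
move=> [[[]|e]|x] [[[]|e']|x'] //=.
- by move/esym/edge_vec_neq0.
- by move/esym/(gamma_neq0 (valP x')).
- by move/edge_vec_neq0.
- by move/edge_vec_inj/val_inj ->.
- by move/esym/(gamma_neq_isolated_edge (valP x') (valP e)).
- by move/(gamma_neq0 (valP x)).
- by move/(gamma_neq_isolated_edge (valP x) (valP e')).
- by move/gamma_inj => /(_ (valP x) (valP x'))/val_inj ->.
Qed.

(** * Matching summands with vertices *)

Definition edge_end e (k : 'I_2) : vertex G :=
  enum_val (cast_ord (esym (G_simple.1 e)) k).

Lemma edge_endP e k : edge_end e k \in ends e.
Proof. exact: enum_valP. Qed.

Lemma edge_end_inj e : injective (edge_end e).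
Proof. by move=> k k' /enum_val_inj/cast_ord_inj. Qed.

Lemma edge_end_surj e x : x \in ends e -> exists k, edge_end e k = x.
Proof.
move=> xe; exists (cast_ord (G_simple.1 e) (enum_rank_in xe x)).
by rewrite /edge_end cast_ordK enum_rankK_in.
Qed.

(* One index for each summand of the decomposition, copies included *)
Definition summand : finType :=
  ('I_#|isolated_vertices G| + {e | e \in isolated_edges G} * 'I_2
   + {x | x \in V_gamma G})%type.

Definition summand_vertex (t : summand) : vertex G :=
  match t with
  | inl (inl i) => enum_val i
  | inl (inr ek) => edge_end (val ek.1) ek.2
  | inr x => val x
  end.

Definition summand_index (t : summand) : simple_index G :=
  match t with
  | inl (inl i) => inl (inl tt)
  | inl (inr ek) => inl (inr ek.1)
  | inr x => inr x
  end.

Lemma gamma_summand_vertex t :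
  gamma (summand_vertex t) = simple_label (summand_index t).
Proof.
case: t => [[i|[e k]]|x] //=; first exact/gamma_isolated/enum_valP.
exact: gamma_isolated_edge (valP e) (edge_endP _ _).
Qed.

Lemma summand_vertex_inj : injective summand_vertex.
Proof.
(* Applying [gamma] recovers the label, hence the simple module; only the copy number remains to be
   compared. *)
move=> s t Est; have := congr1 (@gamma G) Est.
rewrite !gamma_summand_vertex => /simple_label_inj.
case: s t Est => [[i|[e k]]|x] [[j|[e' k']]|y] //= Est.
- by move/enum_val_inj: Est ->.
- by move=> [ee]; move: Est; rewrite -ee => /edge_end_inj ->.
- by move=> [->].
Qed.

Lemma summand_vertex_surj x : exists t, summand_vertex t = x.
Proof.
have [xI | xI] := boolP (x \in isolated_vertices G).
  by exists (inl (inl (enum_rank_in xI x))); rewrite /= enum_rankK_in.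
have [xE | xE] := boolP (x \in \bigcup_(e in isolated_edges G) ends e).
  have [e he /edge_end_surj[k <-]] := bigcupP xE.
  by exists (inl (inr (exist _ e he, k))).
have xV : x \in V_gamma G by rewrite in_setC in_setU negb_or xI.
by exists (inr (exist _ x xV)).
Qed.

(** A chosen preimage, which injectivity of [summand_vertex] makes a two-sided inverse. *)
Definition vertex_summand x : summand := sval (cid (summand_vertex_surj x)).

Lemma vertex_summandK : cancel vertex_summand summand_vertex.
Proof. by move=> x; apply: svalP (cid (summand_vertex_surj x)). Qed.

Lemma summand_vertexK : cancel summand_vertex vertex_summand.
Proof. by move=> t; apply: summand_vertex_inj; rewrite vertex_summandK. Qed.

(** * The isomorphism, vertex by vertex in coordinates *)

Variable K : fieldType.

Definition decomposition : lmodType (Ralg G K) :=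
  ({ffun 'I_#|isolated_vertices G| -> xi_ideal K (0 : edge_space G)}
   * dsum (fun e : {e | e \in isolated_edges G} =>
             {ffun 'I_2 -> xi_ideal K (edge_vec (val e))} : lmodType (Ralg G K))
   * dsum (fun x : {x | x \in V_gamma G} => xi_ideal K (gamma (val x))))%type.

Definition decompose (f : graph_module G K) : decomposition :=
  (([ffun i => xi_line 0 (f (enum_val i))],
    [ffun e => [ffun k => xi_line (edge_vec (val e)) (f (edge_end (val e) k))]]),
   [ffun x => xi_line (gamma (val x)) (f (val x))]).

Definition summand_coord (w : decomposition) (t : summand) : K :=
  match t with
  | inl (inl i) => xi_coord (w.1.1 i)
  | inl (inr ek) => xi_coord (w.1.2 ek.1 ek.2)
  | inr x => xi_coord (w.2 x)
  end.

Definition recompose (w : decomposition) : graph_module G K :=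
  [ffun x => summand_coord w (vertex_summand x)].

Lemma recompose_summand w t : recompose w (summand_vertex t) = summand_coord w t.
Proof. by rewrite ffunE summand_vertexK. Qed.

Lemma decomposeK : cancel decompose recompose.
Proof.
move=> f; apply/ffunP=> x; rewrite -[x]vertex_summandK recompose_summand.
by case: (vertex_summand x) => [[i|[e k]]|y] /=; rewrite !ffunE xi_lineK.
Qed.

Lemma recomposeK : cancel recompose decompose.
Proof.
move=> w; rewrite [RHS]surjective_pairing [w.1 in RHS]surjective_pairing.
congr (_, _, _).
- by apply/ffunP=> i; rewrite ffunE (recompose_summand w (inl (inl i))) xi_coordK.
- apply/ffunP=> e; rewrite ffunE; apply/ffunP=> k.
  by rewrite ffunE (recompose_summand w (inl (inr (e, k)))) xi_coordK.
- by apply/ffunP=> x; rewrite ffunE (recompose_summand w (inr x)) xi_coordK.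
Qed.

Lemma decompose_linear : linear decompose.
Proof.
move=> r f g; congr (_, _, _).
(* At a vertex x, r acts by [eval_chi (gamma x) r]; in each case [gamma x] is the label of the
   target ideal, where r acts by the same scalar. *)
- apply/ffunP=> i; rewrite !ffunE (gamma_isolated (enum_valP i)).
  exact: xi_line_linear.
- apply/ffunP=> e; rewrite !ffunE; apply/ffunP=> k; rewrite !ffunE.
  rewrite (gamma_isolated_edge (valP e) (edge_endP _ k)); exact: xi_line_linear.
- by apply/ffunP=> x; rewrite !ffunE; apply: xi_line_linear.
Qed.

Lemma graph_module_iso : module_iso (graph_module G K) decomposition.
Proof.
pose h := GRing.isLinear.Build _ _ _ _ decompose decompose_linear.
pose F : {linear graph_module G K -> decomposition} := HB.pack decompose h.
by exists F; exists recompose; [apply: decomposeK | apply: recomposeK].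
Qed.

End Labels.

Theorem theorem5p3 (p : nat) (p_prime : prime p) (p_odd : odd p)
    (K : closedFieldType) (iota : {rmorphism 'F_p -> K})
    (K_alg : forall z : K, algebraicOver iota z)
    (G : graph) (hE : (1 <= #|edge G|)%N) (G_simple : simple_graph G) :
  [/\ module_iso
        (graph_module G K)
        (({ffun 'I_#|isolated_vertices G| -> xi_ideal K (0 : edge_space G)}
          * dsum (fun e : {e | e \in isolated_edges G} =>
                    {ffun 'I_2 -> xi_ideal K (edge_vec (val e))} : lmodType (Ralg G K))
          * dsum (fun x : {x | x \in V_gamma G} =>
                    xi_ideal K (gamma (val x))))%type : lmodType (Ralg G K)),
      forall i : simple_index G, simple_module (xi_ideal K (simple_label i)),
      forall i j : simple_index G, i <> j ->
        ~ module_iso (xi_ideal K (simple_label i)) (xi_ideal K (simple_label j))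
    & forall i : simple_index G,
        is_ideal (fun r : Ralg G K =>
                    r \in principal_ideal (xi K (simple_label i)))].
Proof.
split=> [|i|i j ij iso_ij|i].
- exact: graph_module_iso.
- exact: xi_ideal_simple.
- apply: ij; apply: (simple_label_inj G_simple).
  exact: xi_ideal_iso_eq (rmorph_Fp_N1_neq1 iota p_prime p_odd) iso_ij.
(* Scaling in the regular module is multiplication in R, so a submodule is an ideal. *)
- split=> [|u v|a u]; [exact: rpred0 | exact: rpredD | exact: rpredZ].
Qed.
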